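(* Let $G$ be a finite simple connected graph containing no cycle of length $3$ and no cycle of length $5$ as a subgraph. Suppose $\kappa>0$ is a real number such that $\kappa_{LLY}(x,y)\ge \kappa$ for every edge $xy$ of $G$. Then $$|V(G)|\le 2^{2/\kappa}.$$ Moreover, equality holds if and only if $G$ is isomorphic to the hypercube $Q_d$ and $\kappa=\frac{2}{d}$ for some positive integer $d$.
   Context: For vertices $u,v$ of a connected graph $G$, $d(u,v)$ is the graph distance, $N(v)$ is the neighborhood of $v$ and $d_v=|N(v)|$ its degree. For $0\le\alpha<1$ and a vertex $x$, the $\alpha$-lazy random walk is the probability distribution $m_x^\alpha$ on $V(G)$ with $m_x^\alpha(x)=\alpha$, $m_x^\alpha(v)=(1-\alpha)/d_x$ for $v\in N(x)$, and $m_x^\alpha(v)=0$ otherwise. For probability distributions $m_1,m_2$ on $V(G)$, a coupling is a map $A:V\times V\to[0,1]$ with $\sum_y A(x,y)=m_1(x)$ and $\sum_x A(x,y)=m_2(y)$, and the transportation distance is $W(m_1,m_2)=\inf_A\sum_{x,y}A(x,y)d(x,y)$ over all couplings $A$. For distinct vertices $x,y$, $\kappa_\alpha(x,y)=1-\frac{W(m_x^\alpha,m_y^\alpha)}{d(x,y)}$, and the Lin–Lu–Yau Ricci curvature is $\kappa_{LLY}(x,y)=\lim_{\alpha\to1}\frac{\kappa_\alpha(x,y)}{1-\alpha}$. The hypercube $Q_d$ is the graph on the subsets of $\{1,\dots,d\}$ in which two subsets are adjacent iff their symmetric difference has exactly one element. *)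

(* Defs.v *)
From HB Require Import structures.
From mathcomp Require Import all_boot all_order all_algebra.
From mathcomp Require Import all_classical all_reals all_analysis.
Set Implicit Arguments. Unset Strict Implicit. Unset Printing Implicit Defensive.
Import Order.TTheory GRing.Theory Num.Theory.
Import numFieldNormedType.Exports.
Local Open Scope ring_scope.
Local Open Scope classical_set_scope.

Section Graph.
Variables (T : finType) (e : rel T).

Definition simple_graph : Prop := symmetric e /\ irreflexive e.
Definition connected_graph : Prop := forall u v : T, connect e u v.

Definition has_cycle (k : nat) : Prop :=
  exists f : 'I_k -> T, injective f /\ forall i : 'I_k, e (f i) (f (ordS i)).

(* graph distance: least k (< #|T|) such that there is a walk of length k
   from u to v (for a connected graph this is the usual distance) *)
Definition gdist (u v : T) : nat :=
  find (fun k => [exists p : k.-tuple T, path e u p && (last u p == v)])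
       (iota 0 #|T|).

Definition degree (x : T) : nat := #|[set y | e x y]|.

Variable R : realType.

Definition lazy_walk (alpha : R) (x : T) (v : T) : R :=
  if v == x then alpha
  else if e x v then (1 - alpha) / (degree x)%:R else 0.

Definition is_coupling (m1 m2 : T -> R) (A : T -> T -> R) : Prop :=
  (forall x y, 0 <= A x y <= 1) /\
  (forall x, \sum_(y : T) A x y = m1 x) /\
  (forall y, \sum_(x : T) A x y = m2 y).

Definition transport_dist (m1 m2 : T -> R) : R :=
  inf [set c | exists A, is_coupling m1 m2 A /\
               c = \sum_(x : T) \sum_(y : T) A x y * (gdist x y)%:R].

Definition kappa_alpha (alpha : R) (x y : T) : R :=
  1 - transport_dist (lazy_walk alpha x) (lazy_walk alpha y) / (gdist x y)%:R.

Definition kappa_LLY (x y : T) : R :=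
  lim ((fun alpha => kappa_alpha alpha x y / (1 - alpha)) @ at_left (1 : R)).

End Graph.

Definition hypercube_adj (d : nat) : rel {set 'I_d} :=
  fun A B => #|(A :\: B) :|: (B :\: A)| == 1%N.

Definition isomorphic_to_hypercube (T : finType) (e : rel T) (d : nat) : Prop :=
  exists f : T -> {set 'I_d}, bijective f /\
    forall x y, e x y = hypercube_adj (f x) (f y).

(* Main.v *)
(** Work on the bipartite double cover, with [f] the distance from a lift of a
    vertex [x0].  Without 3- and 5-cycles a local piece of [f] descends to a
    function that is 1-Lipschitz between the balls around the ends of an edge,
    so the curvature bound gives [kappa <= Lap f z - Lap f w] along each cover
    edge [z w] with [f w = f z + 1], hence [Lap f <= 1 - kappa f].  As the cover
    is bipartite, [G t = sum_z deg z * t ^ f z] then satisfies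
    [(1 + t) G' <= (2 / kappa) G] on the unit interval, so
    [G 1 <= deg x0 * 2 ^ (2 / kappa)]; take [x0] of minimal degree.  In the
    equality case the graph is regular and [Lap f = 1 - kappa f] for every base
    point; the differences [dist x0 - dist u], for [u] adjacent to [x0], are
    then signs, and they are the hypercube coordinates. *)
Require Import Defs.
From HB Require Import structures.
From mathcomp Require Import all_boot all_order all_algebra.
From mathcomp Require Import all_classical all_reals all_analysis.
From mathcomp Require Import ring lra zify.
Set Implicit Arguments. Unset Strict Implicit. Unset Printing Implicit Defensive.
Import Order.TTheory GRing.Theory Num.Theory.
Import numFieldNormedType.Exports.
Local Open Scope ring_scope.

(** * Graph distance: shortest walks, predecessors and symmetry *)

Section GraphDistance.
Variables (T : finType) (e : rel T).

Lemma gdist_le (u : T) (p : seq T) : path e u p -> (gdist e u (last u p) <= size p)%N.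
Proof.
move=> up; rewrite /gdist; set P := (P in find P _).
have Pp : P (size p) by apply/existsP; exists (in_tuple p); rewrite up eqxx.
(* A failed [find] returns [#|T|], so walks of at least that length satisfy the bound trivially. *)
have [lt_p|le_p] := ltnP (size p) #|T|.
  rewrite leqNgt; apply/negP => /(before_find 0%N).
  by rewrite nth_iota // Pp.
by apply: leq_trans le_p; rewrite -[leqRHS](size_iota 0) find_size.
Qed.

(** Shortening a walk to a duplicate-free path brings its length below [#|T|], so the search in
    [gdist] succeeds. *)
Lemma gdistP (u v : T) : connect e u v ->
  exists p, [/\ path e u p, last u p = v & size p = gdist e u v].
Proof.
move=> /connectP[p0 up0 ->]; case/shortenP: up0 => p up uniq_p _.
have lt_p : (size p < #|T|)%N.
  by have := card_uniqP uniq_p => /= <-; exact: max_card.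
rewrite /gdist; set P := (P in find P _).
have hasP : has P (iota 0 #|T|).
  apply/hasP; exists (size p); first by rewrite mem_iota.
  by apply/existsP; exists (in_tuple p); rewrite up eqxx.
have := nth_find 0%N hasP; rewrite nth_iota ?add0n; last first.
  by rewrite -[ltnRHS](size_iota 0) -has_find.
move=> /existsP[q /andP[uq /eqP lq]].
by exists q; rewrite uq lq size_tuple.
Qed.

Lemma gdistxx (u : T) : gdist e u u = 0%N.
Proof. by apply/eqP; rewrite -leqn0 -[leqRHS]/(size (@nil T)) (@gdist_le u [::]). Qed.

Lemma gdist_eq0 (u v : T) : connect e u v -> gdist e u v = 0%N -> u = v.
Proof. by move=> /gdistP[p [_ <- <-]] /size0nil ->. Qed.

Lemma gdist_walk (u v : T) (p : seq T) : connect e u v -> path e v p ->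
  (gdist e u (last v p) <= gdist e u v + size p)%N.
Proof.
move=> /gdistP[q [uq vE <-]] vp.
by rewrite -size_cat -vE -last_cat gdist_le // cat_path uq vE.
Qed.

Lemma gdist_pred (u v : T) (n : nat) : connect e u v -> gdist e u v = n.+1 ->
  exists w, [/\ connect e u w, e w v & gdist e u w = n].
Proof.
move=> /gdistP[p [up vE sE]] dE; rewrite dE in sE.
case/lastP: p up vE sE => // p w; rewrite rcons_path last_rcons size_rcons.
move=> /andP[up ew] wE [sE]; rewrite wE in ew; exists (last u p).
have cu : connect e u (last u p) by apply/connectP; exists p.
split=> //; apply/eqP; rewrite eqn_leq -{1}sE gdist_le //=.
have := @gdist_walk u _ [:: v] cu; rewrite /= ew => /(_ isT).
by rewrite dE addn1 ltnS.
Qed.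

Lemma gdist_sym (u v : T) : symmetric e -> connect e u v ->
  gdist e u v = gdist e v u.
Proof.
move=> sym.
have H a b : connect e a b -> (gdist e b a <= gdist e a b)%N.
  move=> /gdistP[p [ap bE <-]]; have := @gdist_le b (rev (belast a p)).
  have -> : last b (rev (belast a p)) = a.
    by case: p ap bE => [_ <- //|c p _ _] /=; rewrite rev_cons last_rcons.
  rewrite size_rev size_belast; apply.
  by rewrite -bE rev_path; apply: sub_path ap => x y; rewrite sym.
move=> uv; apply/eqP; rewrite eqn_leq !H //.
by rewrite (sym_connect_sym sym).
Qed.

End GraphDistance.

(** * Bipartite double cover: lifting and projecting walks *)

Section BipartiteDoubleCover.
Variables (T : finType) (e : rel T).
Hypothesis e_sym : symmetric e.

Definition double_cover : rel (T * bool) :=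
  fun z w => e z.1 w.1 && (w.2 == ~~ z.2).

Lemma double_cover_sym : symmetric double_cover.
Proof. by move=> [x []] [y []]; rewrite /double_cover /= e_sym. Qed.

Lemma double_cover_lift (s : bool) (u : T) (p : seq T) : path e u p ->
  exists q, [/\ path double_cover (u, s) q,
    last (u, s) q = (last u p, odd (size p) (+) s) & size q = size p].
Proof.
elim: p u s => [|w p IH] u s /=; first by exists [::].
move=> /andP[uw /(IH _ (~~ s))[q [wq lq sq]]].
exists ((w, ~~ s) :: q); split; rewrite /= ?sq //.
  by rewrite wq /double_cover /= uw eqxx.
by rewrite lq addbN addNb.
Qed.

Lemma double_cover_proj (z : T * bool) (q : seq (T * bool)) :
  path double_cover z q ->
  path e z.1 (map fst q) /\ (last z q).2 = odd (size q) (+) z.2.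
Proof.
elim: q z => [|w q IH] z //= /andP[/andP[zw /eqP w2] /IH[-> ->]].
by rewrite zw w2 addbN addNb.
Qed.

Variable z0 : T * bool.
Local Notation f := (gdist double_cover z0).

Lemma cover_dist_parity (z : T * bool) : connect double_cover z0 z ->
  z.2 = odd (f z) (+) z0.2.
Proof. by move=> /gdistP[q [zq <- <-]]; have [_ ->] := double_cover_proj zq. Qed.

(** Distances at the two ends of an edge differ by at most 1, and they cannot agree because the
    sheet records their parity. *)
Lemma cover_dist_edge (z w : T * bool) : connect double_cover z0 z ->
  double_cover z w -> connect double_cover z0 w /\
  (f w = (f z).+1 \/ f z = (f w).+1).
Proof.
move=> cz zw; have cw := connect_trans cz (connect1 zw); split=> //.
have wz : double_cover w z by rewrite double_cover_sym.
have := @gdist_walk _ _ _ _ [:: w] cz; rewrite /= zw => /(_ isT).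
have := @gdist_walk _ _ _ _ [:: z] cw; rewrite /= wz => /(_ isT).
have pz := cover_dist_parity cz; have pw := cover_dist_parity cw.
have /andP[_ /eqP w2] := zw; rewrite w2 pz in pw.
by move: pw; case: z0.2; move: (f z) (f w) => a b; lia.
Qed.

Lemma gdist_le_cover_dist (z : T * bool) : connect double_cover z0 z ->
  (gdist e z0.1 z.1 <= f z)%N.
Proof.
move=> /gdistP[q [zq <- <-]]; have [pq _] := double_cover_proj zq.
by rewrite -(size_map fst) -last_map gdist_le.
Qed.

Lemma cover_dist_lift (v : T) : connect e z0.1 v -> exists s,
  connect double_cover z0 (v, s) /\ (f (v, s) <= gdist e z0.1 v)%N.
Proof.
move=> /gdistP[p [up <- <-]]; have [q [zq lq sq]] := double_cover_lift z0.2 up.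
rewrite -surjective_pairing in zq lq.
exists (odd (size p) (+) z0.2); rewrite -lq -sq; split; last exact: gdist_le.
by apply/connectP; exists q.
Qed.

End BipartiteDoubleCover.

(** * Excluding closed walks of length 3 and 5 *)

Section NoShortOddCycle.
Variables (T : finType) (e : rel T).
Hypotheses (e_sym : symmetric e) (e_irr : irreflexive e).
Hypotheses (noC3 : ~ has_cycle e 3) (noC5 : ~ has_cycle e 5).

Lemma no_closed_walk3 (a b c : T) : e a b -> e b c -> e c a -> False.
Proof.
move=> ab bc ca; apply: noC3.
have neq x y : e x y -> (x == y) = false.
  by move=> xy; apply/eqP => xyE; rewrite xyE e_irr in xy.
exists (tnth [tuple a; b; c]); split.
  apply/tuple_uniqP; rewrite /= !inE (neq a b) // (neq b c) //.
  by rewrite [a == c]eq_sym (neq c a).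
by case=> [[|[|[|]]]] // i3; rewrite !(tnth_nth a).
Qed.

(** If two vertices two steps apart coincide, cutting out the backtrack leaves a closed walk of
    length 3; otherwise the five vertices are distinct and form a 5-cycle. *)
Lemma no_closed_walk5 (a b c d x : T) :
  e a b -> e b c -> e c d -> e d x -> e x a -> False.
Proof.
move=> ab bc cd dx xa.
have neq y z : e y z -> (y == z) = false.
  by move=> yz; apply/eqP => yzE; rewrite yzE e_irr in yz.
have [ac|ac] := eqVneq a c; first by rewrite -ac in cd; exact: (no_closed_walk3 cd dx xa).
have [bd|bd] := eqVneq b d; first by rewrite -bd in dx; exact: (no_closed_walk3 ab dx xa).
have [cx|cx] := eqVneq c x; first by rewrite -cx in xa; exact: (no_closed_walk3 ab bc xa).
have [da|da] := eqVneq d a; first by rewrite da in cd; exact: (no_closed_walk3 ab bc cd).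
have [xb|xb] := eqVneq x b; first by rewrite xb in dx; exact: (no_closed_walk3 bc cd dx).
apply: noC5; exists (tnth [tuple a; b; c; d; x]); split.
  apply/tuple_uniqP; rewrite /= !inE (neq a b) // (neq b c) // (neq c d) // (neq d x) //.
  by rewrite !negb_or ac bd cx [a == x]eq_sym (neq x a) // [a == d]eq_sym da [b == x]eq_sym xb.
by case=> [[|[|[|[|[|]]]]]] // i5; rewrite !(tnth_nth a).
Qed.

End NoShortOddCycle.

(** * Lazy walks, transport duality and the limit curvature *)

Section LazyWalkTransport.
Variables (R : realType) (T : finType) (e : rel T).
Hypotheses (e_sym : symmetric e) (e_irr : irreflexive e).
Hypothesis e_con : connected_graph e.

Lemma degreeE (x : T) : degree e x = #|[pred y | e x y]|.
Proof.
apply: eq_card => y; rewrite [RHS]unfold_in /=.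
by apply/idP/idP => [/set_mem //|xy]; apply: mem_set.
Qed.

Lemma degree_gt0 (x y : T) : e x y -> (0 < degree e x)%N.
Proof. by move=> xy; rewrite degreeE; apply/card_gt0P; exists y. Qed.

Lemma lazy_walk_sum (alpha : R) (x : T) (h : T -> R) :
  \sum_v lazy_walk e alpha x v * h v =
  alpha * h x + (1 - alpha) * ((\sum_(v | e x v) h v) / (degree e x)%:R).
Proof.
rewrite (bigD1 x) //= {1}/lazy_walk eqxx; congr (_ + _).
rewrite mulr_suml mulr_sumr big_mkcond [RHS]big_mkcond /=.
apply: eq_bigr => v _; rewrite /lazy_walk; case: eqVneq => [->|_].
  by rewrite e_irr.
by case: ifP => _; [ring | rewrite mul0r].
Qed.

Lemma lazy_walk_ge0 (alpha : R) (x v : T) : 0 <= alpha <= 1 ->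
  0 <= lazy_walk e alpha x v.
Proof.
move=> /andP[a0 a1]; rewrite /lazy_walk; do !case: ifP => // _.
by rewrite divr_ge0 // subr_ge0.
Qed.

Lemma lazy_walk_sum1 (alpha : R) (x y : T) : e x y ->
  \sum_v lazy_walk e alpha x v = 1.
Proof.
move=> xy; under eq_bigr do rewrite -[lazy_walk _ _ _ _]mulr1.
rewrite lazy_walk_sum sumr_const -degreeE divff; first by ring.
by rewrite pnatr_eq0 -lt0n (degree_gt0 xy).
Qed.

Lemma lazy_walk_le1 (alpha : R) (x y v : T) : 0 <= alpha <= 1 -> e x y ->
  lazy_walk e alpha x v <= 1.
Proof.
move=> a01 xy; rewrite -(lazy_walk_sum1 alpha xy) (bigD1 v) //= lerDl.
by apply: sumr_ge0 => w _; exact: lazy_walk_ge0.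
Qed.

Lemma lazy_walk_supp (alpha : R) (x v : T) : lazy_walk e alpha x v != 0 ->
  v = x \/ e x v.
Proof.
rewrite /lazy_walk; case: (eqVneq v x) => [->|_]; first by left.
by case: ifP => [xv _|_]; [right | rewrite eqxx].
Qed.

Lemma gdist_edge (x y : T) : e x y -> gdist e x y = 1%N.
Proof.
move=> xy; apply/eqP; rewrite eqn_leq; apply/andP; split.
  by have := @gdist_le _ e x [:: y]; rewrite /= xy; apply.
rewrite lt0n; apply/eqP => /(gdist_eq0 (e_con x y)) xyE.
by rewrite xyE e_irr in xy.
Qed.

(* The easy half of Kantorovich duality: [g] need only be 1-Lipschitz
   between the two supports. *)
Lemma transport_dist_ge (alpha : R) (x y : T) (g : T -> R) :
  0 <= alpha <= 1 -> e x y ->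
  (forall u v, u = x \/ e x u -> v = y \/ e y v ->
    g v - g u <= (gdist e u v)%:R) ->
  \sum_v lazy_walk e alpha y v * g v - \sum_u lazy_walk e alpha x u * g u <=
  transport_dist e (lazy_walk e alpha x) (lazy_walk e alpha y).
Proof.
move=> a01 xy lip; have yx : e y x by rewrite e_sym.
apply: lb_le_inf.
  (* The product coupling makes the set of costs nonempty, so a lower bound of the set is a lower
     bound of its [inf]. *)
  pose A u v := lazy_walk e alpha x u * lazy_walk e alpha y v.
  exists (\sum_u \sum_v A u v * (gdist e u v)%:R), A; split=> //; split.
    move=> u v; rewrite /A mulr_ge0 ?lazy_walk_ge0 //=.
    by rewrite mulr_ile1 ?lazy_walk_ge0 ?(lazy_walk_le1 _ a01 xy) ?(lazy_walk_le1 _ a01 yx).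
  split=> [u|v]; rewrite /A.
    by rewrite -mulr_sumr (lazy_walk_sum1 _ yx) mulr1.
  by rewrite -mulr_suml (lazy_walk_sum1 _ xy) mul1r.
move=> _ [A [[A01 [Ax Ay]] ->]].
have -> : \sum_v lazy_walk e alpha y v * g v = \sum_u \sum_v A u v * g v.
  by rewrite exchange_big; apply: eq_bigr => v _; rewrite -Ay mulr_suml.
have -> : \sum_u lazy_walk e alpha x u * g u = \sum_u \sum_v A u v * g u.
  by apply: eq_bigr => u _; rewrite -Ax mulr_suml.
rewrite -sumrB; apply: ler_sum => u _; rewrite -sumrB; apply: ler_sum => v _.
(* A pair carrying positive mass lies in the two supports, which is where [lip] applies. *)
rewrite -mulrBr; have [->|A0] := eqVneq (A u v) 0; first by rewrite !mul0r.
have Agt : 0 < A u v by rewrite lt0r A0; have /andP[-> _] := A01 u v.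
have A_ge0 a b : 0 <= A a b by have /andP[] := A01 a b.
apply: ler_wpM2l; first exact: ltW.
apply: lip; apply: (@lazy_walk_supp alpha); apply: lt0r_neq0; apply: lt_le_trans Agt _.
  by rewrite -Ax (bigD1 v) //= lerDl sumr_ge0.
by rewrite -Ay (bigD1 u) //= lerDl sumr_ge0.
Qed.

(** Since [g y = g x + 1], duality bounds [kappa_alpha] by [1 - alpha] times the right-hand side;
    the quotient bound is free of [alpha] and passes to the limit. *)
Lemma kappa_LLY_le (kappa : R) (x y : T) (g : T -> R) :
  0 < kappa -> kappa <= kappa_LLY e R x y -> e x y ->
  (forall u v, u = x \/ e x u -> v = y \/ e y v ->
    g v - g u <= (gdist e u v)%:R) ->
  g y = g x + 1 ->
  kappa <= (\sum_(u | e x u) (g u - g x)) / (degree e x)%:R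
         - (\sum_(v | e y v) (g v - g y)) / (degree e y)%:R.
Proof.
move=> k0 le_k xy lip gy; have yx : e y x by rewrite e_sym.
have avg z w (zw : e z w) : (\sum_(u | e z u) (g u - g z)) / (degree e z)%:R =
    (\sum_(u | e z u) g u) / (degree e z)%:R - g z.
  rewrite sumrB sumr_const -degreeE mulrBl -[g z *+ _]mulr_natr mulfK //.
  by rewrite pnatr_eq0 -lt0n (degree_gt0 zw).
rewrite (avg _ _ xy) (avg _ _ yx).
(* If the defining limit did not exist, [lim] would be the junk value 0. *)
have cv : cvg ((kappa_alpha e alpha x y / (1 - alpha)) @[alpha --> (1 : R)^'-])%classic.
  apply: contrapT => /dvgP dv; move: (lt_le_trans k0 le_k).
  by rewrite /kappa_LLY dv ltxx.
apply: le_trans le_k _; apply: limr_le => //.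
near=> alpha; have a1 : alpha < 1 by near: alpha; exact: nbhs_left_lt.
have a0 : 0 < alpha by near: alpha; exact: nbhs_left_gt.
have a01 : 0 <= alpha <= 1 by rewrite !ltW.
rewrite ler_pdivrMr ?subr_gt0 // /kappa_alpha gdist_edge // divr1.
have := transport_dist_ge a01 xy lip; rewrite !lazy_walk_sum gy.
set W := transport_dist _ _ _; set X := _ / (degree e x)%:R.
set Y := _ / (degree e y)%:R; move: X Y W => X Y W leW.
by nra.
Unshelve. all: by end_near. Qed.

End LazyWalkTransport.

(** * From a Laplacian bound to exponential growth of the degree sum *)

Section LaplacianGrowth.
Variables (R : realType) (U : finType) (adj : rel U) (C : pred U) (f : U -> nat).
Hypothesis adj_sym : symmetric adj.
Hypothesis C_closed : forall z w, C z -> adj z w -> C w.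
Hypothesis f_edge : forall z w, C z -> adj z w ->
  f w = (f z).+1 \/ f z = (f w).+1.

Let deg (z : U) : nat := #|[pred w | adj z w]|.
Let lap (z : U) : R := \sum_(w | adj z w) ((f w)%:R - (f z)%:R).

Lemma sum_edges_sym (a : U -> U -> R) :
  \sum_(z | C z) \sum_(w | adj z w) a z w =
  \sum_(z | C z) \sum_(w | adj z w) a w z.
Proof.
rewrite (exchange_big_dep C) /=; last by move=> z w; exact: C_closed.
apply: eq_bigr => z Cz; apply: eq_bigl => w; rewrite adj_sym andb_idl // => zw.
exact: C_closed Cz zw.
Qed.

(** An edge between levels [n] and [n + 1] contributes [t ^ n * (1 - t)] to the Laplacian sum and
    [t ^ n * (1 + t)] to the degree sum. *)
Lemma sum_lap_geometric (t : R) :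
  (1 + t) * \sum_(z | C z) lap z * t ^+ f z =
  (1 - t) * \sum_(z | C z) (deg z)%:R * t ^+ f z.
Proof.
have sym2 (a : U -> U -> R) : 2 * \sum_(z | C z) \sum_(w | adj z w) a z w =
    \sum_(z | C z) \sum_(w | adj z w) (a z w + a w z).
  transitivity (\sum_(z | C z) \sum_(w | adj z w) a z w +
                \sum_(z | C z) \sum_(w | adj z w) a w z).
    by rewrite -sum_edges_sym; ring.
  by rewrite -big_split; apply: eq_bigr => z _; rewrite -big_split.
have -> : \sum_(z | C z) lap z * t ^+ f z =
    \sum_(z | C z) \sum_(w | adj z w) ((f w)%:R - (f z)%:R) * t ^+ f z.
  by apply: eq_bigr => z _; rewrite mulr_suml.
have -> : \sum_(z | C z) (deg z)%:R * t ^+ f z =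
    \sum_(z | C z) \sum_(w | adj z w) t ^+ f z.
  by apply: eq_bigr => z _; rewrite sumr_const mulr_natl.
have two_neq0 : (2 : R) != 0 by rewrite pnatr_eq0.
(* Doubling and symmetrizing both sums reduces the identity to a single edge. *)
apply: (mulfI two_neq0); rewrite mulrCA [RHS]mulrCA !sym2 !mulr_sumr.
apply: eq_bigr => z Cz; rewrite !mulr_sumr; apply: eq_bigr => w zw.
by case: (f_edge Cz zw) => ->; rewrite exprS -natr1; ring.
Qed.

Variable kappa : R.
Hypothesis kappa_gt0 : 0 < kappa.
Hypothesis lap_le : forall z, C z -> lap z <= (deg z)%:R * (1 - kappa * (f z)%:R).

Let G : {poly R} := \sum_(z | C z) (deg z)%:R *: 'X^(f z).

Let hornerG (t : R) : G.[t] = \sum_(z | C z) (deg z)%:R * t ^+ f z.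
Proof.
by rewrite horner_sum; apply: eq_bigr => z _; rewrite hornerZ hornerXn.
Qed.

(** The right-hand side is the exact defect, up to a factor, in the differential inequality for [G];
    an identity is kept because the equality case needs each summand. Multiplying the derivative by
    [t] restores the exponent [f z]. *)
Lemma level_poly_deriv (t : R) :
  2 * t * G.[t] - kappa * (1 + t) * (t * G^`().[t]) =
  (1 + t) * \sum_(z | C z)
    ((deg z)%:R * (1 - kappa * (f z)%:R) - lap z) * t ^+ f z.
Proof.
have -> : t * G^`().[t] = \sum_(z | C z) (deg z)%:R * (f z)%:R * t ^+ f z.
  rewrite [G^`()]raddf_sum horner_sum mulr_sumr; apply: eq_bigr => z _.
  rewrite /= derivZ hornerZ derivXn hornerMn hornerXn.
  by case: (f z) => [|n] /=; [ring | rewrite exprS -mulr_natr; ring].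
have -> : \sum_(z | C z) ((deg z)%:R * (1 - kappa * (f z)%:R) - lap z) * t ^+ f z =
    G.[t] - kappa * \sum_(z | C z) (deg z)%:R * (f z)%:R * t ^+ f z
    - \sum_(z | C z) lap z * t ^+ f z.
  by rewrite hornerG mulr_sumr -!sumrB; apply: eq_bigr => z _; ring.
have := sum_lap_geometric t; rewrite -hornerG.
set L := \sum_(z | C z) lap z * _ => LE.
by rewrite [in RHS]mulrBr LE; ring.
Qed.

(** Here [A] and [M] are the values of [G] at 0 and 1. The mean value theorem is applied to [Phi],
    the logarithm of [G t / (1 + t) ^ (2 / kappa)], whose derivative is at most 0 on the open unit
    interval. *)
Lemma sum_degree_growth : let A := \sum_(z | C z && (f z == 0)%N) deg z in
  (0 < A)%N ->
  let M := \sum_(z | C z) deg z in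
  M%:R <= A%:R * 2 `^ (2 / kappa) /\
  (M%:R = A%:R * 2 `^ (2 / kappa) ->
   forall z, C z -> lap z = (deg z)%:R * (1 - kappa * (f z)%:R)).
Proof.
move=> A A_gt0 M.
have G0 : G.[0] = A%:R.
  rewrite hornerG /A natr_sum big_mkcondr; apply: eq_bigr => z _.
  by rewrite expr0n; case: (f z == 0)%N; rewrite ?mulr1 ?mulr0.
have G1 : G.[1] = M%:R.
  by rewrite hornerG /M natr_sum; apply: eq_bigr => z _; rewrite expr1n mulr1.
have G_gt0 (t : R) : 0 <= t -> 0 < G.[t].
  move=> t0; apply: (@lt_le_trans _ _ A%:R); first by rewrite ltr0n.
  rewrite -G0 !hornerG; apply: ler_sum => z _; rewrite ler_wpM2l //.
  by case: (f z) => [|n] //; rewrite expr0n exprn_ge0.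
pose D := 2 / kappa.
pose Phi (t : R) := ln G.[t] - D * ln (1 + t).
pose dPhi (t : R) := G^`().[t] / G.[t] - D / (1 + t).
have dPhiP (t : R) : 0 <= t -> is_derive t 1 Phi (dPhi t).
  move=> t0; have Gt := G_gt0 t t0.
  have t1 : 0 < 1 + t by lra.
  have d1 := is_derive1_comp (is_derive1_ln Gt) (is_derive_poly G t).
  have d2 : is_derive t (1 : R) (fun s : R => 1 + s) 1.
    by have := is_deriveD (is_derive_cst (1 : R) t 1) (is_derive_id t 1); rewrite add0r.
  have d3 := is_derive1_comp (is_derive1_ln t1) d2.
  have := is_deriveB d1 (is_deriveZ D d3).
  set df := (X in is_derive _ _ _ X); suff -> : df = dPhi t by [].
  by rewrite /df /dPhi /GRing.scale /=; ring.
have [||c c01 PhiE] := @MVT R Phi dPhi 0 1 ltr01.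
- by move=> t /[!in_itv] /= /andP[/ltW /dPhiP].
- apply: derivable_within_continuous => t /[!in_itv] /= /andP[/dPhiP d _].
  exact: ex_derive.
have /andP[c0 c1] : 0 < c < 1 by move: c01; rewrite in_itv.
have Gc := G_gt0 c (ltW c0).
have dPhiE : kappa * (1 + c) * c * G.[c] * dPhi c =
    - ((1 + c) * \sum_(z | C z)
    ((deg z)%:R * (1 - kappa * (f z)%:R) - lap z) * c ^+ f z).
  rewrite -level_poly_deriv /dPhi /D; field.
  by rewrite !gt_eqF //; lra.
have defect_ge0 z : C z ->
    0 <= ((deg z)%:R * (1 - kappa * (f z)%:R) - lap z) * c ^+ f z.
  by move=> Cz; rewrite mulr_ge0 ?exprn_ge0 ?(ltW c0) // subr_ge0 lap_le.
have coef_gt0 : 0 < kappa * (1 + c) * c * G.[c] by rewrite !mulr_gt0 //; lra.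
have Phi01 : Phi 1 - Phi 0 = ln M%:R - ln (A%:R * 2 `^ D).
  rewrite /Phi G0 G1 addr0 ln1 mulr0 subr0 lnM ?posrE ?powR_gt0 ?ltr0n //.
  by rewrite ln_powR (_ : 1 + 1 = 2) //; ring.
have M_gt0 : 0 < M%:R :> R by rewrite -G1 G_gt0.
have B_gt0 : 0 < A%:R * 2 `^ D by rewrite mulr_gt0 ?powR_gt0 ?ltr0n.
rewrite Phi01 subr0 mulr1 in PhiE; split.
  rewrite -ler_ln ?posrE // -subr_le0 PhiE -(pmulr_rle0 _ coef_gt0) dPhiE.
  by rewrite oppr_le0 mulr_ge0 ?sumr_ge0 //; lra.
(* Equality makes [dPhi c] vanish; since [c > 0], every nonnegative defect is then zero. *)
move=> ME; rewrite ME subrr in PhiE.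
move: dPhiE; rewrite -PhiE mulr0 => /esym/eqP; rewrite oppr_eq0 mulf_eq0.
rewrite gt_eqF /=; last by lra.
rewrite psumr_eq0 // => /allP all0 z Cz.
have /= := all0 z (mem_index_enum z); rewrite Cz /= mulf_eq0 expf_eq0.
by rewrite (gt_eqF c0) andbF orbF subr_eq0 => /eqP.
Qed.

End LaplacianGrowth.

(** * Hypercube coordinates from the Laplacian identity *)

Section HypercubeRecognition.
Variables (R : realType) (T : finType) (e : rel T).
Hypotheses (e_sym : symmetric e) (e_con : connected_graph e).
Local Notation dist := (gdist e).
Hypothesis dist_edge : forall x v w, e v w ->
  dist x w = (dist x v).+1 \/ dist x v = (dist x w).+1.
Variable d : nat.
Hypothesis dist_lap : forall x v,
  \sum_(w | e v w) ((dist x w)%:R - (dist x v)%:R) = d%:R - 2 * (dist x v)%:R :> R.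
Variables (x0 : T) (u : 'I_d -> T).
Hypothesis sum_nbrs : forall F : T -> R, \sum_(w | e x0 w) F w = \sum_i F (u i).
Hypothesis u_edge : forall i, e x0 (u i).
Hypothesis card_vertices : #|T| = (2 ^ d)%N.

Let distC x y : dist x y = dist y x.
Proof. exact: gdist_sym e_sym (e_con x y). Qed.

(* The coordinates of [v] are the neighbours of [x0] lying on a geodesic
   from [x0] to [v]. *)
Let phi (v : T) : {set 'I_d} := [set i | (dist (u i) v < dist x0 v)%N]%SET.

Let side i v : (dist x0 v)%:R - (dist (u i) v)%:R = (if i \in phi v then 1 else -1) :> R.
Proof.
rewrite inE; have := dist_edge v (u_edge i); rewrite ![dist v _]distC.
by case=> ->; rewrite -natr1; [rewrite ltnNge leqnSn|rewrite ltnSn]; ring.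
Qed.

(** The Laplacian of [dist v] at [x0] is a sum of signs, equal to [d - 2 * #|phi v|]; compare with
    [dist_lap]. *)
Let card_phi v : #|phi v| = dist x0 v.
Proof.
have := dist_lap v x0; rewrite sum_nbrs.
under eq_bigr => i _ do rewrite ![dist v _]distC -opprB side.
rewrite sumrN => sumE; apply/eqP; rewrite -(eqr_nat R).
have card_sum : \sum_i (if i \in phi v then 1 else -1) =
    2 * #|phi v|%:R - d%:R :> R.
  have -> : d%:R = \sum_(i < d) 1 :> R by rewrite sumr_const card_ord.
  rewrite -sum1_card natr_sum [in RHS]big_mkcond mulr_sumr -sumrB /=.
  by apply: eq_bigr => i _; case: ifP => _; ring.
rewrite card_sum distC in sumE.
by apply/eqP; move: sumE; lra.
Qed.

(** A step away from [x0] loses no coordinate, and by [card_phi] it gains exactly one. *)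
Let phi_up v w : e v w -> dist x0 w = (dist x0 v).+1 -> hypercube_adj (phi v) (phi w).
Proof.
move=> vw dE; have sub : phi v \subset phi w.
  apply/fintype.subsetP => i; rewrite !inE dE => lt_i.
  by have := dist_edge (u i) vw; lia.
have D0 : phi v :\: phi w = finset.set0 by apply/eqP; rewrite finset.setD_eq0.
by rewrite /hypercube_adj D0 finset.set0U cardsDS // !card_phi dE subSnn.
Qed.

Let hypercube_adjC (A B : {set 'I_d}) : hypercube_adj A B = hypercube_adj B A.
Proof. by rewrite /hypercube_adj finset.setUC. Qed.

Let phi_edge v w : e v w -> hypercube_adj (phi v) (phi w).
Proof.
move=> vw; have wv : e w v by rewrite e_sym.
by case: (dist_edge x0 vw) => dE; [|rewrite hypercube_adjC]; exact: phi_up.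
Qed.

Let adj_flip (A B : {set 'I_d}) i : hypercube_adj A B -> (i \in A) != (i \in B) ->
  forall j, (j \in B) = (j \in A) (+) (j == i).
Proof.
move=> /cards1P[k ABE] iAB j.
have mem_k l : (l \in A) != (l \in B) = (l == k).
  have /setP/(_ l) := ABE; rewrite !inE => <-.
  by case: (l \in A); case: (l \in B).
have ik : i = k by apply/eqP; rewrite -mem_k.
by rewrite ik -mem_k; case: (j \in A); case: (j \in B).
Qed.

(* [dist x0 - dist (u i)] is a sign-valued eigenfunction of the Laplacian,
   so it cannot be constant on a closed neighbourhood. *)
Let phi_flip v i : exists2 w, e v w & (i \in phi v) != (i \in phi w).
Proof.
apply: contrapT => noflip.
have same w : e v w -> (i \in phi w) = (i \in phi v).
  by move=> vw; apply/eqP/negPn/negP => neq; apply: noflip; exists w; rewrite // eq_sym.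
have : \sum_(w | e v w) (((dist x0 w)%:R - (dist x0 v)%:R) -
    ((dist (u i) w)%:R - (dist (u i) v)%:R)) = 0 :> R.
  apply: big1 => w vw; have := side i v; have := side i w.
  by rewrite same //; case: ifP => _; lra.
by rewrite sumrB !dist_lap; have := side i v; case: ifP => _; lra.
Qed.

Let phi_step v i : exists2 w, e v w & forall j, (j \in phi w) = (j \in phi v) (+) (j == i).
Proof.
have [w vw flip] := phi_flip v i; exists w => //.
exact: adj_flip (phi_edge vw) flip.
Qed.

(** Induction on [#|A|] from [phi x0], which is empty: [phi_step] adds a removed element back. *)
Let phi_surj A : exists v, phi v == A.
Proof.
have [n] := ubnP #|A|; elim: n A => // n IH A le_n.
have [A0|[i iA]] := finset.set_0Vmem A.
  by exists x0; rewrite A0 -cards_eq0 card_phi gdistxx.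
have [|v /eqP phiv] := IH (A :\ i); first by rewrite [#|A|](cardsD1 i) iA in le_n.
have [w _ phiw] := phi_step v i; exists w; apply/eqP/setP => j.
by rewrite phiw phiv !inE; case: eqVneq => [->|_]; rewrite ?iA ?addbF.
Qed.

Lemma card_finset (I : finType) : #|{set I}| = (2 ^ #|I|)%N.
Proof. by rewrite -[LHS]finset.cardsT -finset.powersetT card_powerset finset.cardsT. Qed.

Lemma hypercube_recognition : isomorphic_to_hypercube e d.
Proof.
pose g A := xchoose (phi_surj A).
have gK : cancel g phi by move=> A; exact/eqP/(xchooseP (phi_surj A)).
have g_bij : bijective g.
  by apply: inj_card_bij (can_inj gK) _; rewrite card_finset card_ord card_vertices.
have phi_bij : bijective phi.
  have [h _ hK] := g_bij; exists g => [v|]; last exact: gK.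
  by rewrite -[v]hK gK.
exists phi; split=> // v w; apply/idP/idP => [/phi_edge //|vw].
(* For the converse, the neighbour of [v] that flips coordinate [i] has the same image as [w], hence
   is [w]. *)
have /cards1P[i ABE] := vw.
have flip : (i \in phi v) != (i \in phi w).
  have /setP/(_ i) := ABE; rewrite !inE eqxx.
  by case: (_ < _)%N; case: (_ < _)%N.
have phiw := adj_flip vw flip; have [w' vw' phiw'] := phi_step v i.
suff -> : w = w' by [].
by apply: (bij_inj phi_bij); apply/setP => j; rewrite phiw phiw'.
Qed.

End HypercubeRecognition.

(** * Curvature on the cover, the vertex bound and its extremal case *)

Section CurvatureAndCover.
Variables (R : realType) (T : finType) (e : rel T) (kappa : R).
Hypotheses (e_sym : symmetric e) (e_irr : irreflexive e).
Hypothesis e_con : connected_graph e.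
Hypotheses (noC3 : ~ has_cycle e 3) (noC5 : ~ has_cycle e 5).
Hypothesis kappa_gt0 : 0 < kappa.
Hypothesis curv : forall x y, e x y -> kappa <= kappa_LLY e R x y.

Local Notation adj := (double_cover e).
Let walk3 := no_closed_walk3 e_irr noC3.
Let walk5 := no_closed_walk5 e_irr noC3 noC5.

Lemma sum_double_cover (x : T) (s : bool) (F : T * bool -> R) :
  \sum_(w | adj (x, s) w) F w = \sum_(u | e x u) F (u, ~~ s).
Proof.
rewrite (eq_bigr (fun w => F (w.1, w.2))) => [|[u t] //].
rewrite -(pair_big [pred u | e x u] [pred t | t == ~~ s] (fun u t => F (u, t))) /=.
by apply: eq_bigr => u _; rewrite big_pred1_eq.
Qed.

Lemma degree_double_cover (x : T) (s : bool) :
  #|[pred w | adj (x, s) w]| = degree e x.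
Proof.
apply/eqP; rewrite -(eqr_nat R) degreeE -!sum1_card !natr_sum.
by rewrite (sum_double_cover x s (fun _ => 1)).
Qed.

Section BasePoint.
Variable z0 : T * bool.
Local Notation C := (connect adj z0).
Local Notation f := (gdist adj z0).

(** Unnormalized Laplacian: the degree factor is carried by the bounds. *)
Definition cover_lap (z : T * bool) : R :=
  \sum_(w | adj z w) ((f w)%:R - (f z)%:R).

Let f_edge z w : C z -> adj z w -> f w = (f z).+1 \/ f z = (f w).+1.
Proof. by move=> Cz zw; have [] := cover_dist_edge e_sym Cz zw. Qed.

(* [f], read on the sheet that the edge [x y] selects at each vertex, is
   1-Lipschitz between the two balls: a walk of length at most 2 between lifts
   of the wrong parity would close up to a walk of length 1, 3 or 5. *)
Let lift_lipschitz (x y : T) (s : bool) (sheet : T -> bool) :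
  (forall u, sheet u = if e x u then ~~ s else s) ->
  C (x, s) -> e x y -> f (y, ~~ s) = (f (x, s)).+1 ->
  forall u v, u = x \/ e x u -> v = y \/ e y v ->
  (f (v, sheet v) <= f (u, sheet u) + gdist e u v)%N.
Proof.
move=> sheetE Cx xy fy u v xu yv.
have yx : e y x by rewrite e_sym.
have {}xu : (u = x /\ sheet u = s) \/ (e x u /\ sheet u = ~~ s).
  by case: xu => [->|xu]; [left|right]; rewrite sheetE ?e_irr ?xu.
have {}yv : (v = y /\ sheet v = ~~ s) \/ (e y v /\ sheet v = s).
  case: yv => [->|yv]; [left|right]; rewrite sheetE ?xy //.
  by case: ifP => // xv; case: (walk3 xy yv); rewrite e_sym.
have Cy : C (y, ~~ s).
  by apply: connect_trans Cx (connect1 _); rewrite /double_cover /= xy eqxx.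
have [Cu fu] : C (u, sheet u) /\ (f (x, s) <= (f (u, sheet u)).+1)%N.
  case: xu => [[-> ->]|[xu ->]]; first by split.
  have xu' : adj (x, s) (u, ~~ s) by rewrite /double_cover /= xu eqxx.
  have [Cu fu] := cover_dist_edge e_sym Cx xu'; split=> //.
  by case: fu => ->; rewrite ?leqnn // -addn2 leq_addr.
have fv : (f (v, sheet v) <= (f (x, s)).+2)%N.
  case: yv => [[-> ->]|[yv ->]]; first by rewrite fy.
  have yv' : adj (y, ~~ s) (v, s) by rewrite /double_cover /= yv negbK eqxx.
  have [_ fv] := cover_dist_edge e_sym Cy yv'; rewrite -fy.
  by case: fv => ->; rewrite ?leqnn // -addn2 leq_addr.
have [p [up pv sp]] := gdistP (e_con u v).
have [q [uq lq sq]] := double_cover_lift (sheet u) up.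
have fq := gdist_walk Cu uq; rewrite lq sq pv sp in fq.
have [par|par] := eqVneq (odd (gdist e u v) (+) sheet u) (sheet v).
  by rewrite par in fq.
(* Distance 3 suffices whatever the parity: [f] rises by at most 1 from the lift of [u] to that of
   [x], and by at most 2 from there to that of [v]. *)
have [long|short] := leqP 3 (gdist e u v).
  by rewrite (leq_trans fv) // -ltnS -addSn (leq_trans _ (leq_add fu long)) // addn3.
exfalso; move: par short; rewrite -sp.
case: p up pv {sp uq lq sq fq} => [|a [|b [|//]]] /=.
- by move=> _ ->; rewrite eqxx.
- rewrite andbT => ua av par _; rewrite {a}av in ua.
  case: xu par => [[uE ->]|[xu ->]]; case: yv => [[vE ->]|[yv ->]];
    rewrite ?negbK ?eqxx //= => _.
  + by rewrite uE in ua; apply: (walk3 xy yv); rewrite e_sym.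
  + by rewrite vE in ua; apply: (walk3 xu ua yx).
- move=> /and3P[ua ab _] bv par _; rewrite {b}bv in ab.
  case: xu par => [[uE ->]|[xu ->]]; case: yv => [[vE ->]|[yv ->]];
    rewrite ?eqxx //= => _.
  + by rewrite uE in ua; rewrite vE in ab; apply: (walk3 ua ab yx).
  + by apply: (walk5 xu ua ab) yx; rewrite e_sym.
Qed.

(** The potential [g] is admissible by [lift_lipschitz]. Its neighbour sums are the two cover
    Laplacians, as no neighbour of [y] is one of [x]. *)
Let curvature_lap_le (x y : T) (s : bool) :
  C (x, s) -> e x y -> f (y, ~~ s) = (f (x, s)).+1 ->
  kappa <= cover_lap (x, s) / (degree e x)%:R
           - cover_lap (y, ~~ s) / (degree e y)%:R.
Proof.
move=> Cx xy fy; have yx : e y x by rewrite e_sym.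
pose sheet u := if e x u then ~~ s else s.
pose g u : R := (f (u, sheet u))%:R.
have gx : g x = (f (x, s))%:R by rewrite /g /sheet e_irr.
have gy : g y = (f (y, ~~ s))%:R by rewrite /g /sheet xy.
have -> : cover_lap (x, s) = \sum_(u | e x u) (g u - g x).
  rewrite /cover_lap sum_double_cover; apply: eq_bigr => u xu.
  by rewrite gx /g /sheet xu.
have -> : cover_lap (y, ~~ s) = \sum_(v | e y v) (g v - g y).
  rewrite /cover_lap sum_double_cover; apply: eq_bigr => v yv.
  rewrite gy negbK /g /sheet; case: ifP => // xv.
  by case: (walk3 xy yv); rewrite e_sym.
apply: kappa_LLY_le => //; first exact: curv.
  move=> u v xu yv; rewrite lerBlDl -natrD ler_nat.
  exact: (lift_lipschitz (sheet := sheet) _ Cx xy fy).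
by rewrite gx gy fy natr1.
Qed.

(** Induction along a geodesic from [z0]: at [z0] every neighbour is at level at most 1, and each
    further step lowers the normalized Laplacian by at least [kappa]. *)
Lemma cover_lap_le (z : T * bool) : C z ->
  cover_lap z <= (degree e z.1)%:R * (1 - kappa * (f z)%:R).
Proof.
have [n] := ubnP (f z); elim: n z => // n IH [y t] lt_n Cy /=.
case fE: (f (y, t)) lt_n => [|k] lt_n.
  rewrite mulr0 subr0 mulr1 /cover_lap -(degree_double_cover y t) -sum1_card natr_sum.
  apply: ler_sum => w yw; rewrite lerBlDr -natrD ler_nat.
  by have := f_edge Cy yw; rewrite fE => -[->|].
have [[x s] [Cx xy fx]] := gdist_pred Cy fE.
have {xy} [xy tE] : e x y /\ t = ~~ s by have /andP[? /eqP] := xy.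
rewrite {t}tE in Cy fE *.
have kap := curvature_lap_le Cx xy; rewrite fx fE in kap.
have dx : 0 < (degree e x)%:R :> R by rewrite ltr0n (degree_gt0 xy).
have dy : 0 < (degree e y)%:R :> R.
  by rewrite ltr0n (@degree_gt0 _ _ y x) // e_sym.
have := IH (x, s); rewrite fx => /(_ lt_n Cx) /=.
rewrite -ler_pdivrMl // [_^-1 * _]mulrC => lapx.
rewrite -ler_pdivrMl // [_^-1 * _]mulrC.
by have := kap erefl; rewrite -natr1; lra.
Qed.

End BasePoint.

Local Notation C x := (connect adj (x, true)).

(** The boolean sum in [M] counts the lifts of [v] in the component of [(x, true)], which may be all
    or half of the cover. *)
Lemma curvature_growth (x : T) : (0 < degree e x)%N ->
  let M := (\sum_v degree e v * (C x (v, true) + C x (v, false)))%N in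
  M%:R <= (degree e x)%:R * 2 `^ (2 / kappa) :> R /\
  (M%:R = (degree e x)%:R * 2 `^ (2 / kappa) :> R ->
   forall z, C x z -> cover_lap (x, true) z =
     (degree e z.1)%:R * (1 - kappa * (gdist adj (x, true) z)%:R)).
Proof.
move=> dx M; pose f z := gdist adj (x, true) z.
have degE (z : T * bool) : #|[pred w | adj z w]| = degree e z.1.
  by case: z => v s; exact: degree_double_cover.
have sumA : \sum_(z | C x z && (f z == 0)%N) #|[pred w | adj z w]| = degree e x.
  rewrite (big_pred1 (x, true)) ?degE // => z; apply/andP/eqP => [[Cz /eqP]|->].
    by move=> /(gdist_eq0 Cz).
  by rewrite connect0 /f gdistxx.
have sumM : \sum_(z | C x z) #|[pred w | adj z w]| = M.
  rewrite big_mkcond /M.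
  rewrite (eq_bigr (fun z => degree e z.1 * C x (z.1, z.2))%N); last first.
    by case=> v s _; rewrite degE /=; case: ifP; rewrite ?muln1 ?muln0.
  rewrite -(pair_bigA _ (fun v s => degree e v * C x (v, s))%N) /=.
  by apply: eq_bigr => v _; rewrite big_bool mulnDr.
have := @sum_degree_growth R _ adj (C x) f (double_cover_sym e_sym).
rewrite sumA sumM; case/(_ _ _ kappa)=> //.
- by move=> z w Cz zw; have [] := cover_dist_edge e_sym Cz zw.
- by move=> z w Cz zw; have [] := cover_dist_edge e_sym Cz zw.
- by move=> z Cz; rewrite degE; exact: cover_lap_le.
by move=> le_M eq_M; split=> // /eq_M lapE z Cz; rewrite -degE -lapE.
Qed.

Lemma cover_fibre_gt0 (x v : T) : (0 < C x (v, true) + C x (v, false))%N.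
Proof.
have [s [Cv _]] := @cover_dist_lift _ e (x, true) v (e_con x v).
by case: s Cv => ->; rewrite ?addn1.
Qed.

(** Each vertex has at least one lift and degree at least that of [x], so [degree e x * #|T|] is at
    most the degree sum of the component. Equality there is termwise and forces regularity and
    single lifts. *)
Lemma card_vertices_le (x : T) : (0 < degree e x)%N ->
  (forall v, degree e x <= degree e v)%N ->
  #|T|%:R <= 2 `^ (2 / kappa) :> R /\
  (#|T|%:R = 2 `^ (2 / kappa) :> R ->
    (forall v, degree e v = degree e x) /\
    (forall v, C x (v, true) + C x (v, false) = 1)%N /\
    (forall z, C x z -> cover_lap (x, true) z =
     (degree e z.1)%:R * (1 - kappa * (gdist adj (x, true) z)%:R))).
Proof.
move=> dx min_x; have [le_M eq_M] := curvature_growth dx.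
set M := (\sum_v _)%N in le_M eq_M.
have dx_gt0 : 0 < (degree e x)%:R :> R by rewrite ltr0n.
have term v : (degree e x * 1 <= degree e v * (C x (v, true) + C x (v, false)))%N.
  by rewrite leq_mul ?cover_fibre_gt0.
have cardE : (degree e x * #|T| = \sum_(v : T) degree e x * 1)%N.
  by rewrite sum_nat_const muln1 mulnC.
have le_cardM : (degree e x * #|T| <= M)%N by rewrite cardE leq_sum.
split=> [|T_eq].
  rewrite -(ler_pM2l dx_gt0); apply: le_trans le_M.
  by rewrite -natrM ler_nat.
have ME : M = (degree e x * #|T|)%N.
  by apply/eqP; rewrite eqn_leq le_cardM andbT -(ler_nat R) natrM T_eq.
have termE v : (degree e x * 1 = degree e v * (C x (v, true) + C x (v, false)))%N.
  apply/eqP; have := leqif_sum (fun i (_ : true) => leqif_eq (term i)).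
  by move=> [_]; rewrite -cardE -/M ME eqxx => /esym /forallP /(_ v).
have fibre v : (C x (v, true) + C x (v, false) = 1)%N.
  have := termE v; have := min_x v; have := cover_fibre_gt0 x v.
  by case: (C x _); case: (C x _) => //=; lia.
split=> [v|]; first by have := termE v; rewrite fibre !muln1.
by split=> //; apply: eq_M; rewrite ME natrM T_eq.
Qed.

(* At extremality the cover splits into two copies of the graph, and the cover
   distance is the graph distance. *)
Lemma extremal_dist (x : T) : (0 < degree e x)%N ->
  (forall v, degree e x <= degree e v)%N ->
  #|T|%:R = 2 `^ (2 / kappa) :> R ->
  (forall v w, e v w -> gdist e x w = (gdist e x v).+1 \/
                        gdist e x v = (gdist e x w).+1) /\
  (forall v, \sum_(w | e v w) ((gdist e x w)%:R - (gdist e x v)%:R) =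
    (degree e x)%:R * (1 - kappa * (gdist e x v)%:R) :> R).
Proof.
move=> dx min_x /(proj2 (card_vertices_le dx min_x)) [regular [fibre lapE]].
have distE v s : C x (v, s) -> gdist adj (x, true) (v, s) = gdist e x v.
  move=> Cv; apply/eqP; rewrite eqn_leq (gdist_le_cover_dist Cv) andbT.
  have [s' [Cv' le_s']] := @cover_dist_lift _ e (x, true) v (e_con x v).
  suff -> : s = s' by [].
  by have := fibre v; case: s s' Cv Cv' {le_s'} => [] [] // -> ->.
have sheet v : exists s, C x (v, s).
  have [s [Cv _]] := @cover_dist_lift _ e (x, true) v (e_con x v).
  by exists s.
have nbr v w s : C x (v, s) -> e v w ->
    C x (w, ~~ s) /\ adj (v, s) (w, ~~ s).
  move=> Cv vw; have vw' : adj (v, s) (w, ~~ s) by rewrite /double_cover /= vw eqxx.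
  by split=> //; exact: connect_trans Cv (connect1 vw').
split=> [v w vw|v]; have [s Cv] := sheet v.
  have [Cw vw'] := nbr v w s Cv vw.
  by have [_] := cover_dist_edge e_sym Cv vw'; rewrite !distE.
rewrite -(regular v) -(distE v s) // -[RHS](lapE (v, s)) // /cover_lap.
rewrite sum_double_cover; apply: eq_bigr => w vw.
by have [Cw _] := nbr v w s Cv vw; rewrite !distE.
Qed.

End CurvatureAndCover.

(** * The bound from a vertex of minimal degree, and the hypercube at equality *)

Theorem theorem1p6 (R : realType) (T : finType) (e : rel T) (kappa : R) :
  simple_graph e -> connected_graph e ->
  ~ has_cycle e 3 -> ~ has_cycle e 5 ->
  0 < kappa ->
  (forall x y : T, e x y -> kappa <= kappa_LLY e R x y) ->
  (#|T|%:R <= 2 `^ (2 / kappa)) /\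
  (#|T|%:R = 2 `^ (2 / kappa) <->
     exists d : nat, (0 < d)%N /\ isomorphic_to_hypercube e d /\
                     kappa = 2 / d%:R).
Proof.
move=> [e_sym e_irr] e_con noC3 noC5 k0 curv.
have powE d : (0 < d)%N -> 2 `^ (2 / (2 / d%:R)) = 2 ^+ d :> R.
  move=> d0; rewrite (_ : 2 / (2 / d%:R) = d%:R) ?powR_mulrn //.
  by field; rewrite pnatr_eq0 -lt0n.
have iso_card : (exists d : nat, (0 < d)%N /\ isomorphic_to_hypercube e d /\
    kappa = 2 / d%:R) -> #|T|%:R = 2 `^ (2 / kappa).
  move=> [d [d0 [[phi [phi_bij _]] ->]]].
  rewrite (bij_eq_card phi_bij) card_finset card_ord natrX.
  by rewrite powE.
have pow_gt1 : 1 < 2 `^ (2 / kappa).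
  rewrite /powR pnatr_eq0 /= expR_gt1 mulr_gt0 ?divr_gt0 //.
  by rewrite ln_gt0 // ltr1n.
(* With at most one vertex there is no edge, but the bound is strict, so both sides of the
   equivalence fail. *)
have [T_le1|T_gt1] := leqP #|T| 1.
  have T_lt : #|T|%:R < 2 `^ (2 / kappa).
    by apply: le_lt_trans pow_gt1; rewrite lern1.
  by split; [exact: ltW | split=> // TE; rewrite TE ltxx in T_lt].
have /card_gt0P[a _] : (0 < #|T|)%N by exact: ltnW.
have degree_pos x : (0 < degree e x)%N.
  have /card_gt1P[b [c [_ _ bc]]] := T_gt1.
  have [y xy] : exists y, y != x.
    by case: (eqVneq b x) => [bx|]; [exists c; rewrite -bx eq_sym | exists b].
  have /connectP[[|w p]] := e_con x y; first by move=> _ yx; rewrite yx eqxx in xy.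
  by move=> /andP[xw _] _; exact: degree_gt0 xw.
have [x min_x] : exists x, forall v, (degree e x <= degree e v)%N.
  exists [arg min_(x < a) degree e x]; case: arg_minnP => // x _ min_x v.
  exact: min_x.
have [le_card eq_card] :=
  card_vertices_le e_sym e_irr e_con noC3 noC5 k0 curv (degree_pos x) min_x.
split=> //; split=> // T_eq.
have [regular _] := eq_card T_eq.
(* Regularity gives every vertex minimal degree, so any of them can serve as base point. *)
have extremal y := extremal_dist e_sym e_irr e_con noC3 noC5 k0 curv (degree_pos y)
  (fun v => eq_leq (etrans (regular y) (esym (regular v)))) T_eq.
pose d := #|[pred y | e x y]|.
have dE : degree e x = d by exact: degreeE.
have d_gt0 : (0 < d)%N by rewrite -dE.
have /card_gt0P[y xy] := d_gt0; rewrite inE in xy.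
have yx : e y x by rewrite e_sym.
(* At a neighbour [y] of [x], one neighbour is [x] and the other [d - 1] are at distance 2, so
   [d - 2 = d * (1 - kappa)]. *)
have kappaE : kappa = 2 / d%:R.
  have := (extremal x).2 y; rewrite (gdist_edge e_irr e_con xy) mulr1 dE.
  rewrite (bigD1 x) //= gdistxx.
  rewrite (eq_bigr (fun=> 1)) => [|w /andP[yw wx]]; last first.
    have := (extremal x).1 y w yw; rewrite (gdist_edge e_irr e_con xy).
    case=> [->|[/esym/(gdist_eq0 (e_con x w)) xw]]; first by rewrite -natr1; ring.
    by rewrite xw eqxx in wx.
  have dyE : d%:R = 1 + \sum_(w | e y w && (w != x)) 1 :> R.
    by rewrite -dE -(regular y) degreeE -sum1_card natr_sum (bigD1 x).
  move: dyE; set S := \sum_(w | _) 1 => dyE sumE.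
  have <- : kappa * d%:R = 2 by lra.
  by rewrite mulfK // pnatr_eq0 -lt0n.
exists d; split=> //; split=> //.
apply: (@hypercube_recognition R T e e_sym e_con _ d _ x (fun i => enum_val i)).
- by move=> z v w vw; exact: (extremal z).1.
- move=> z v; rewrite (extremal z).2 (regular z) dE kappaE; field.
  by rewrite pnatr_eq0 -lt0n.
- by move=> F; rewrite -(big_enum_val (fun w => F w)).
- by move=> i; have := enum_valP i; rewrite inE.
apply/eqP; rewrite -(eqr_nat R) natrX T_eq kappaE.
by rewrite powE.
Qed.
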